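(* Let $X$ be a compact Hausdorff space, $A=C(X)$, $T:X\to X$ a local homeomorphism such that $\alpha:A\to A$, $\alpha(a)=a\circ T$, is an injective endomorphism. Let $L:A\to A$ be a normalized transfer operator for $\alpha$ such that the conditional expectation $E=\alpha\circ L:A\to\alpha(A)$ has finite index. Let $h\in A$ be a strictly positive function, let $\beta\in\mathbb{R}$, and put $\Lambda=h^{-\beta}\,\mathrm{ind}(E)\in A$. Let $F:A\rtimes_{\alpha,L}\mathbb{N}\to A$ be the canonical conditional expectation. If $\psi=\phi\circ F$, with $\phi$ a state on $A$, is an $(h,\beta)$-KMS state of $A\rtimes_{\alpha,L}\mathbb{N}$, and $L(\Lambda 1)=1$, then $\phi$ is an equilibrium state (in $A$) for the potential $h^{-\beta}$.
   Context: States: a state on a unital C*-algebra is a positive linear functional with value $1$ at the unit. Transfer operators: a transfer operator for $\alpha$ is a positive linear map $L:A\to A$ with $L(\alpha(a)b)=aL(b)$ for all $a,b\in A$; it is normalized if $L(1)=1$. Since $T$ is a local homeomorphism, every transfer operator is of the form $L_{\rho}(a)(x)=\sum_{T(y)=x}\rho(y)a(y)$ with $\rho:X\to[0,\infty)$ continuous. Finite index: $E=\alpha\circ L$ has finite index if there is a finite family $u_1,\dots,u_m\in A$ with $a=\sum_i u_iE(u_i^*a)$ for all $a\in A$; then $\mathrm{ind}(E)=\sum_i u_iu_i^*$ (independent of the family, and invertible). Crossed product: let $\mathcal{T}(A,\alpha,L)$ be the universal unital C*-algebra generated by a copy of $A$ and an element $S$ subject to $Sa=\alpha(a)S$ and $S^*aS=L(a)$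 for all $a\in A$. A redundancy is a pair $(a,k)$ with $a\in A$ and $k$ in the closed linear span of $ASS^*A$ such that $abS=kbS$ for all $b\in A$. The crossed product $A\rtimes_{\alpha,L}\mathbb{N}$ is the quotient of $\mathcal{T}(A,\alpha,L)$ by the closed two-sided ideal generated by the differences $a-k$ over all redundancies $(a,k)$; $A$ embeds in it, and the image of $S$ is still denoted $S$. The canonical conditional expectation $F:A\rtimes_{\alpha,L}\mathbb{N}\to A$ is determined by $F(aS^n(S^* )^mb)=\delta_{n,m}\,a\,I_n^{-1}\,b$ for $a,b\in A$, $n,m\geq0$, where $I_n=\prod_{i=0}^{n-1}\alpha^i(\mathrm{ind}(E))$. KMS states: $h$ determines the one-parameter group of automorphisms $\sigma$ of $A\rtimes_{\alpha,L}\mathbb{N}$ with $\sigma_t(a)=a$ for $a\in A$ and $\sigma_t(S)=h^{it}S$. An $(h,\beta)$-KMS state is a state $\psi$ such that $\psi(xy)=\psi(y\,\sigma_{i\beta}(x))$ for all $y$ and all analytic $x$ (those for which $t\mapsto\sigma_t(x)$ extends analytically to $\mathbb{C}$). Entropy, pressure, equilibrium states: let $A_+$ be the set of strictly positive functions in $A$ (spectrum contained in $(0,\infty)$). For a state $\phi$ on $A$, $$\mathrm{Ent}(\phi)=\inf_{a\in A_+}\phi\left(\ln\left(\frac{L_{\rho_0}(a)}{\rho_0\,a}\right)\right),$$ where $\rho_0:X\to(0,\infty)$ is any continuous function; the value does not depend on $\rho_0$. A state $\phi$ on $A$ is $\alpha$-invariant if $\phi\circ\alpha=\phi$. For $b\in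 A_+$ the pressure is $p(b)=\sup\{\mathrm{Ent}(\phi)+\phi(\ln b):\phi\ \alpha\text{-invariant state on }A\}$, and an equilibrium state for (the potential) $b$ is an $\alpha$-invariant state $\phi$ with $\mathrm{Ent}(\phi)+\phi(\ln b)=p(b)$. *)

(* Defs.v *)
From HB Require Import structures.
From mathcomp Require Import all_boot all_order all_algebra.
From mathcomp Require Import all_classical all_reals all_analysis.
From mathcomp Require Import complex lra.

Set Implicit Arguments.
Unset Strict Implicit.
Unset Printing Implicit Defensive.

Import Order.TTheory GRing.Theory Num.Theory.
Import numFieldNormedType.Exports.
Local Open Scope classical_set_scope.
Local Open Scope ring_scope.
Local Open Scope complex_scope.

(* [complex R] seen through its numFieldType structure, so that it carries the
   topology and the norm of numFieldNormedType. *)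
Notation Cplx R := (Num.NumField.sort (complex R)).

HB.mixin Record isStarAlgebra (R : realType) B of GRing.Algebra R[i] B := {
  star : B -> B;
  starK : forall x : B, star (star x) = x;
  starD : forall x y : B, star (x + y) = star x + star y;
  starM : forall x y : B, star (x * y) = star y * star x;
  starZ : forall (k : R[i]) (x : B), star (k *: x) = conjc k *: star x }.

#[short(type="starAlgType")]
HB.structure Definition StarAlgebra (R : realType) :=
  {B of isStarAlgebra R B & GRing.Algebra R[i] B}.

(* The hierarchies of rings and of normed modules have no declared join, so
   the product is part of the mixin; the ring and *-algebra instances on the
   carrier follow. *)
HB.mixin Record isCStarAlgebra (R : realType) B
    of CompleteNormedModule R[i] B := {
  cs_one : B;
  cs_mul : B -> B -> B;
  cs_star : B -> B;
  cs_mulA : associative cs_mul;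
  cs_mul1l : left_id cs_one cs_mul;
  cs_mul1r : right_id cs_one cs_mul;
  cs_mulDl : left_distributive cs_mul +%R;
  cs_mulDr : right_distributive cs_mul +%R;
  cs_one_neq0 : cs_one != 0;
  cs_scaleAl : forall (k : R[i]) x y, k *: cs_mul x y = cs_mul (k *: x) y;
  cs_scaleAr : forall (k : R[i]) x y, k *: cs_mul x y = cs_mul x (k *: y);
  cs_starK : forall x, cs_star (cs_star x) = x;
  cs_starD : forall x y, cs_star (x + y) = cs_star x + cs_star y;
  cs_starM : forall x y, cs_star (cs_mul x y) = cs_mul (cs_star y) (cs_star x);
  cs_starZ : forall (k : R[i]) x, cs_star (k *: x) = conjc k *: cs_star x;
  cs_normM : forall x y, `|cs_mul x y| <= `|x| * `|y|;
  cs_identity : forall x, `|cs_mul (cs_star x) x| = `|x| ^+ 2 }.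

#[short(type="cstarAlgType")]
HB.structure Definition CStarAlgebra (R : realType) :=
  {B of isCStarAlgebra R B & CompleteNormedModule R[i] B}.

Section CStarAlgebraInstances.
Context (R : realType) (B : cstarAlgType R).

HB.instance Definition _ := GRing.Zmodule_isNzRing.Build (CStarAlgebra.sort B)
  cs_mulA cs_mul1l cs_mul1r cs_mulDl cs_mulDr cs_one_neq0.
HB.instance Definition _ :=
  GRing.Lmodule_isLalgebra.Build R[i] (CStarAlgebra.sort B) cs_scaleAl.
HB.instance Definition _ :=
  GRing.Lalgebra_isAlgebra.Build R[i] (CStarAlgebra.sort B) cs_scaleAr.
HB.instance Definition _ := isStarAlgebra.Build R (CStarAlgebra.sort B)
  cs_starK cs_starD cs_starM cs_starZ.

End CStarAlgebraInstances.

Section StarAlgebras.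
Context {R : realType}.

Definition star_morphism (A B : starAlgType R) (f : A -> B) :=
  [/\ linear f, monoid_morphism f & forall x, f (star x) = star (f x)].

Definition positive_elt (A : starAlgType R) (x : A) :=
  exists y : A, x = star y * y.

Definition positive_map (A B : starAlgType R) (f : A -> B) :=
  forall x, positive_elt x -> positive_elt (f x).

Definition is_state (A : starAlgType R) (phi : A -> R[i]) :=
  [/\ scalar phi, forall x, positive_elt x -> 0 <= phi x & phi 1 = 1].

Definition conditional_expectation (A B : starAlgType R)
    (j : A -> B) (F : B -> A) :=
  [/\ linear F, positive_map F, forall a, F (j a) = a &
      forall a x b, F (j a * x * j b) = a * F x * b].

Definition linear_span (V : lmodType R[i]) (D : set V) : set V :=
  [set x | exists n (c : 'I_n -> R[i]) (d : 'I_n -> V),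
     (forall i, D (d i)) /\ x = \sum_(i < n) c i *: d i].

End StarAlgebras.

(* The norm of a complex normed space takes its values in [R[i]]. *)
Definition rnorm (R : realType) (B : cstarAlgType R) (x : B) : R := complex.Re `|x|.

Section CStarAlgebras.
Context {R : realType} (B : cstarAlgType R).

Definition closed_star_subalgebra (D : set B) :=
  [/\ closed D, D 1, forall k x y, D x -> D y -> D (k *: x + y),
      forall x y, D x -> D y -> D (x * y) & forall x, D x -> D (star x)].

Definition closed_ideal (J : set B) :=
  [/\ closed J, J 0, forall x y, J x -> J y -> J (x + y) &
      forall x y, J x -> J (x * y) /\ J (y * x)].

(* [q] exhibits [Q] as the quotient C*-algebra of [B] by the closed ideal [J],
   with the quotient norm. *)
Definition is_quotient (J : set B) (Q : cstarAlgType R) (q : B -> Q) :=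
  [/\ star_morphism q, forall y, exists x, q x = y,
      forall x, q x = 0 <-> J x &
      forall x, rnorm (q x) = inf [set rnorm (x + k) | k in J]].

Definition one_parameter_group (sigma : R -> B -> B) :=
  [/\ forall t, star_morphism (sigma t), forall x, sigma 0 x = x,
      forall s t x, sigma (s + t) x = sigma s (sigma t x) &
      forall x, continuous (sigma ^~ x)].

Definition entire (f : Cplx R -> B) := forall z, derivable f z 1.

(* An analytic [x] is one for which [t |-> sigma t x] has an entire extension
   [f]; this extension is unique and [f (i * beta)] is sigma_(i beta)(x). *)
Definition kms_state (sigma : R -> B -> B) (beta : R) (psi : B -> R[i]) :=
  is_state psi /\
  forall (x y : B) (f : Cplx R -> B),
    entire f -> (forall t : R, f t%:C = sigma t x) ->
    psi (x * y) = psi (y * f (0 +i* beta)).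

End CStarAlgebras.

Fact Re_cts (R : realType) (Y : topologicalType) (f : Y -> Cplx R) :
  continuous f -> continuous (fun y => complex.Re (f y)).
Proof.
move=> f_cts y; apply/cvgrPdist_lt => e e0.
have e0' : 0 < e%:C by rewrite ltcR.
have /(@cvgrPdist_lt _ (Cplx R)) /(_ _ e0') := f_cts y.
apply: filterS => z; rewrite -raddfB /=; case: (f y - f z) => a b /=.
rewrite normc_def /= ltcR; apply: le_lt_trans.
by rewrite -sqrtr_sqr ler_wsqrtr// lerDl sqr_ge0.
Qed.

Fact complex_cts (R : realType) (Y : topologicalType) (f g : Y -> R) :
  continuous f -> continuous g ->
  continuous ((fun y => f y +i* g y) : Y -> Cplx R).
Proof.
move=> f_cts g_cts y; apply/(@cvgrPdist_lt _ (Cplx R)) => -[e e'].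
rewrite ltcE /= => /andP[/eqP -> e0].
have e20 : 0 < e / 2 by rewrite divr_gt0.
have /cvgrPdist_lt /(_ _ e20) f_near := f_cts y.
have /cvgrPdist_lt /(_ _ e20) := g_cts y.
apply: filterS2 f_near => z fz gz.
rewrite [X in `|X|](_ : _ = (f y - f z) +i* (g y - g z))//.
rewrite normc_def /= ltcR -(ltr_pXn2r (n := 2)) ?nnegrE ?sqrtr_ge0 ?(ltW e0)//.
rewrite sqr_sqrtr ?addr_ge0 ?sqr_ge0//.
move: fz gz; rewrite !ltr_norml.
move: (f y - f z) (g y - g z) => p q /andP[p1 p2] /andP[q1 q2]; nra.
Qed.

(* The *-algebra C(X).  The base point only records that X is nonempty. *)

Record cfun (R : realType) (X : ptopologicalType) := Cfun {
  cval :> X -> R[i];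
  cfun_cts : continuous (cval : X -> Cplx R) }.

HB.instance Definition _ R X := gen_eqMixin (cfun R X).
HB.instance Definition _ R X := gen_choiceMixin (cfun R X).

Section ContinuousFunctions.
Context (R : realType) (X : ptopologicalType).
Implicit Types a b : cfun R X.

Lemma cfunP a b : (forall x, a x = b x) -> a = b.
Proof.
case: a b => [f f_cts] [g g_cts] /= /funext fg.
by case: _ / fg g_cts => g_cts; rewrite (Prop_irrelevance f_cts g_cts).
Qed.

Fact cfun_add_cts a b : continuous ((fun x => a x + b x) : X -> Cplx R).
Proof. by move=> x; apply: (@cvgD _ (Cplx R)); exact: cfun_cts. Qed.

Fact cfun_opp_cts a : continuous ((fun x => - a x) : X -> Cplx R).
Proof. by move=> x; apply: (@cvgN _ (Cplx R)); exact: cfun_cts. Qed.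

Fact cfun_mul_cts a b : continuous ((fun x => a x * b x) : X -> Cplx R).
Proof. by move=> x; apply: cvgM; exact: cfun_cts. Qed.

Fact cfun_cst_cts (k : R[i]) : continuous ((fun=> k) : X -> Cplx R).
Proof. by move=> x; exact: cvg_cst. Qed.

Fact cfun_conj_cts a : continuous ((fun x => conjc (a x)) : X -> Cplx R).
Proof.
move=> x; apply/(@cvgrPdist_lt _ (Cplx R)) => e e0.
have /(@cvgrPdist_lt _ (Cplx R)) /(_ e e0) := @cfun_cts _ _ a x.
by apply: filterS => y; rewrite -rmorphB /= normcJ.
Qed.

Let cadd a b := Cfun (@cfun_add_cts a b).
Let copp a := Cfun (@cfun_opp_cts a).
Let cmul a b := Cfun (@cfun_mul_cts a b).
Let ccst k := Cfun (@cfun_cst_cts k).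
Let cscale (k : R[i]) a := cmul (ccst k) a.
Let cconj a := Cfun (@cfun_conj_cts a).

Let caddA : associative cadd.
Proof. by move=> a b c; apply: cfunP => x; exact: addrA. Qed.
Let caddC : commutative cadd.
Proof. by move=> a b; apply: cfunP => x; exact: addrC. Qed.
Let cadd0 : left_id (ccst 0) cadd.
Proof. by move=> a; apply: cfunP => x; exact: add0r. Qed.
Let caddN : left_inverse (ccst 0) copp cadd.
Proof. by move=> a; apply: cfunP => x; exact: addNr. Qed.

HB.instance Definition _ :=
  GRing.isZmodule.Build (cfun R X) caddA caddC cadd0 caddN.

Let cmulA : associative cmul.
Proof. by move=> a b c; apply: cfunP => x; exact: mulrA. Qed.
Let cmulC : commutative cmul.
Proof. by move=> a b; apply: cfunP => x; exact: mulrC. Qed.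
Let cmul1 : left_id (ccst 1) cmul.
Proof. by move=> a; apply: cfunP => x; exact: mul1r. Qed.
Let cmulDl : left_distributive cmul +%R.
Proof. by move=> a b c; apply: cfunP => x; exact: mulrDl. Qed.
Let c1_neq0 : ccst 1 != 0.
Proof.
apply/eqP => /(congr1 (fun a : cfun R X => cval a point)) /= /eqP.
by rewrite [_ == _]oner_eq0.
Qed.

HB.instance Definition _ :=
  GRing.Zmodule_isComNzRing.Build (cfun R X) cmulA cmulC cmul1 cmulDl c1_neq0.

Let cscaleA (k l : R[i]) a : cscale k (cscale l a) = cscale (k * l) a.
Proof. by apply: cfunP => x; exact: mulrA. Qed.
Let cscale1 : left_id 1 cscale.
Proof. by move=> a; apply: cfunP => x; exact: mul1r. Qed.
Let cscaleDr : right_distributive cscale +%R.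
Proof. by move=> k a b; apply: cfunP => x; exact: mulrDr. Qed.
Let cscaleDl a : {morph cscale^~ a : k l / k + l}.
Proof. by move=> k l; apply: cfunP => x; exact: mulrDl. Qed.

HB.instance Definition _ := GRing.Zmodule_isLmodule.Build R[i] (cfun R X)
  cscaleA cscale1 cscaleDr cscaleDl.

Let cscaleAl (k : R[i]) a b : k *: (a * b) = (k *: a) * b.
Proof. by apply: cfunP => x; exact: mulrA. Qed.

HB.instance Definition _ :=
  GRing.Lmodule_isLalgebra.Build R[i] (cfun R X) cscaleAl.
HB.instance Definition _ := GRing.Lalgebra_isComAlgebra.Build R[i] (cfun R X).

Let cconjK a : cconj (cconj a) = a.
Proof. by apply: cfunP => x; exact: conjcK. Qed.
Let cconjD a b : cconj (a + b) = cconj a + cconj b.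
Proof. by apply: cfunP => x; exact: (rmorphD (@conjc R)). Qed.
Let cconjM a b : cconj (a * b) = cconj b * cconj a.
Proof. by rewrite mulrC; apply: cfunP => x; exact: (rmorphM (@conjc R)). Qed.
Let cconjZ (k : R[i]) a : cconj (k *: a) = conjc k *: cconj a.
Proof. by apply: cfunP => x; exact: (rmorphM (@conjc R)). Qed.

HB.instance Definition _ :=
  isStarAlgebra.Build R (cfun R X) cconjK cconjD cconjM cconjZ.

Lemma cfunDE a b x : (a + b) x = a x + b x. Proof. by []. Qed.
Lemma cfunME a b x : (a * b) x = a x * b x. Proof. by []. Qed.
Lemma cfun1E x : (1 : cfun R X) x = 1. Proof. by []. Qed.
Lemma cfunZE k a x : (k *: a) x = k * a x. Proof. by []. Qed.
Lemma cfun_starE a x : (star a) x = conjc (a x). Proof. by []. Qed.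

Definition sup_norm a : R := sup (range (fun x => complex.Re `|a x|)).

Definition strictly_positive a := forall x, 0 < a x.

(* [mkcfun f] is [f] as an element of C(X).  The default value 0, for [f] not
   continuous, is never used below: under the standing assumptions (X compact
   Hausdorff, T a local homeomorphism, functions to be inverted without zeros)
   every function to which [mkcfun] is applied is continuous. *)
Definition mkcfun (f : X -> Cplx R) : cfun R X :=
  if pselect (continuous f) is left f_cts then Cfun f_cts else 0.

Lemma mkcfunE (f : X -> Cplx R) (x : X) : continuous f -> mkcfun f x = f x.
Proof. by rewrite /mkcfun; case: pselect. Qed.

(* Functional calculus; used for [a] strictly positive and [g] continuous on
   the open half line of positive reals. *)
Definition cfun_calc (g : R -> Cplx R) a := mkcfun (fun x => g (complex.Re (a x))).

Definition cfun_ln a := cfun_calc (fun r => (ln r)%:C) a.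
Definition cfun_pow a (s : R) := cfun_calc (fun r => (r `^ s)%:C) a.
(* a^(i t) = exp(i t ln a) *)
Definition cfun_ipow a (t : R) := cfun_calc (fun r => cos (t * ln r) +i* sin (t * ln r)) a.
Definition cfun_inv a := mkcfun (fun x => (a x)^-1).

Lemma Re_gt0 a x : strictly_positive a -> 0 < complex.Re (a x).
Proof. by move/(_ x); case: (a x) => p q; rewrite ltcE /= => /andP[]. Qed.

Lemma ln_cts a : strictly_positive a -> continuous (fun x => ln (complex.Re (a x))).
Proof.
move=> a0 x; apply: (@continuous_comp X R R).
  exact: (@Re_cts _ _ _ (@cfun_cts _ _ a) x).
by apply: continuous_ln; exact: Re_gt0.
Qed.

Lemma cfun_lnE a x : strictly_positive a -> cfun_ln a x = (ln (complex.Re (a x)))%:C.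
Proof.
move=> a0; apply: mkcfunE; apply: complex_cts; first exact: ln_cts.
by move=> y; exact: cvg_cst.
Qed.

Lemma cfun_powE a s x : strictly_positive a ->
  cfun_pow a s x = (complex.Re (a x) `^ s)%:C.
Proof.
move=> a0; apply: mkcfunE; apply: complex_cts; last by move=> y; exact: cvg_cst.
under eq_fun => y do rewrite /powR gt_eqF ?Re_gt0//.
move=> y; apply: (@continuous_comp X R R); last exact: continuous_expR.
by apply: cvgM; [exact: cvg_cst|exact: ln_cts].
Qed.

Lemma cfun_ipowE a t x : strictly_positive a ->
  cfun_ipow a t x = cos (t * ln (complex.Re (a x))) +i* sin (t * ln (complex.Re (a x))).
Proof.
move=> a0; apply: mkcfunE; apply: complex_cts => y; apply: (@continuous_comp X R R).
- by apply: cvgM; [exact: cvg_cst|exact: ln_cts].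
- exact: continuous_cos.
- by apply: cvgM; [exact: cvg_cst|exact: ln_cts].
- exact: continuous_sin.
Qed.

Lemma cfun_invE a x : (forall y, a y != 0) -> cfun_inv a x = (a x)^-1.
Proof.
move=> a0; apply: mkcfunE => y; apply: cvgV; first exact: a0.
exact: cfun_cts.
Qed.

End ContinuousFunctions.

Section Dynamics.
Context {R : realType} {X : ptopologicalType} (T : X -> X).
Local Notation A := (cfun R X).

Definition local_homeomorphism := forall x, exists U : set X,
  [/\ open U, U x, {in U &, injective T}, {in U, continuous T} &
      forall V, open V -> V `<=` U -> open (T @` V)].

Definition alpha (a : A) : A := mkcfun (fun x => a (T x)).

Lemma alphaE (a : A) x : continuous T -> alpha a x = a (T x).
Proof.
move=> T_cts; apply: mkcfunE => y.
apply: (@continuous_comp X X (Cplx R) T a); first exact: T_cts.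
by have := @cfun_cts _ _ a (T y).
Qed.

Definition transfer_operator (L : A -> A) :=
  [/\ linear L, positive_map L & forall a b, L (alpha a * b) = a * L b].

(* L_rho(a)(x) is the sum of rho(y) a(y) over the (finite) fibre of x. *)
Definition transfer (rho a : A) : A :=
  mkcfun (fun x => \sum_(y \in [set y | T y = x]) rho y * a y).

Definition quasi_basis (E : A -> A) (m : nat) (u : 'I_m -> A) :=
  forall a, a = \sum_(i < m) u i * E (star (u i) * a).

Definition ind (m : nat) (u : 'I_m -> A) : A :=
  \sum_(i < m) u i * star (u i).

Definition invariant_state (phi : A -> R[i]) :=
  is_state phi /\ forall a, phi (alpha a) = phi a.

Definition Ent (rho0 : A) (phi : A -> R[i]) : \bar R :=
  ereal_inf [set (complex.Re
      (phi (cfun_ln (transfer rho0 a * cfun_inv (rho0 * a)))))%:E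
    | a in [set a | strictly_positive a]].

Definition pressure_functional (rho0 b : A) (phi : A -> R[i]) : \bar R :=
  (Ent rho0 phi + (complex.Re (phi (cfun_ln b)))%:E)%E.

Definition pressure (rho0 b : A) : \bar R :=
  ereal_sup [set pressure_functional rho0 b phi
            | phi in [set phi | invariant_state phi]].

Definition equilibrium_state (rho0 b : A) (phi : A -> R[i]) :=
  invariant_state phi /\ pressure_functional rho0 b phi = pressure rho0 b.

End Dynamics.

Section CrossedProduct.
Context {R : realType} {X : ptopologicalType} (T : X -> X).
Local Notation A := (cfun R X).
Variable L : A -> A.

Definition toeplitz_relations (D : cstarAlgType R) (pi : A -> D) (s : D) :=
  [/\ star_morphism pi,
      forall a, s * pi a = pi (alpha T a) * s &
      forall a, star s * pi a * s = pi (L a)].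

Definition is_toeplitz (D : cstarAlgType R) (iota : A -> D) (S : D) :=
  [/\ toeplitz_relations iota S,
      forall a, rnorm (iota a) = sup_norm a,
      smallest (@closed_star_subalgebra R D) (S |` range iota) = setT &
      forall (D' : cstarAlgType R) (pi : A -> D') (s : D'),
        toeplitz_relations pi s ->
        exists f : D -> D',
          [/\ star_morphism f, forall a, f (iota a) = pi a & f S = s]].

Definition redundancy (D : cstarAlgType R) (iota : A -> D) (S : D)
    (a : A) (k : D) :=
  closure (linear_span
    [set iota b * S * star S * iota c | b in [set: A] & c in [set: A]]) k /\
  forall b, iota a * iota b * S = k * iota b * S.

Definition redundancy_ideal (D : cstarAlgType R) (iota : A -> D) (S : D) :
    set D :=
  smallest (@closed_ideal R D)
    [set d | exists a k, redundancy iota S a k /\ d = iota a - k].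

(* [B], with [j] the embedding of A and [S] the canonical isometry, is the
   crossed product. *)
Definition is_crossed_product (B : cstarAlgType R) (j : A -> B) (S : B) :=
  exists (D : cstarAlgType R) (iota : A -> D) (S0 : D) (q : D -> B),
    [/\ is_toeplitz iota S0, is_quotient (redundancy_ideal iota S0) q,
        forall a, j a = q (iota a) & S = q S0].

(* [d] stands for ind(E). *)
Definition canonical_expectation (d : A) (B : cstarAlgType R) (j : A -> B)
    (S : B) (F : B -> A) :=
  conditional_expectation j F /\
  forall (a b : A) (n m : nat),
    F (j a * S ^+ n * star S ^+ m * j b) =
    if n == m then a * cfun_inv (\prod_(i < n) iter i (alpha T) d) * b else 0.

Definition dynamics (h : A) (B : cstarAlgType R) (j : A -> B) (S : B)
    (sigma : R -> B -> B) :=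
  [/\ one_parameter_group sigma, forall t a, sigma t (j a) = j a &
      forall t, sigma t S = j (cfun_ipow h t) * S].

End CrossedProduct.

(* Main.v *)
From HB Require Import structures.
Require Import Defs.
From mathcomp Require Import all_boot all_order all_algebra.
From mathcomp Require Import finmap.
From mathcomp Require Import all_classical all_reals all_analysis.
From mathcomp Require Import complex ring lra.

Set Implicit Arguments.
Unset Strict Implicit.
Unset Printing Implicit Defensive.

Import Order.TTheory GRing.Theory Num.Theory.
Import numFieldNormedType.Exports.
Local Open Scope classical_set_scope.
Local Open Scope ring_scope.
Local Open Scope complex_scope.

(* Put b = h^(-beta).  The KMS condition for S and S^* j(ind(E) a) reads
   phi(a) = phi(L(b ind(E) a)); since L(b ind(E)) = 1, this makes phi invariant.
   A quasi-basis forces L(ind(E) c)(x) to be the sum of c over the fibre of x,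
   so the operator L_rho0 in the entropy is a |-> L(ind(E) rho0 a).  The test
   function b / rho0 then gives Ent(psi) + psi(ln b) <= 0 for every state psi,
   while Jensen's inequality for the unital positive map a |-> L(b ind(E) a)
   gives the reverse inequality for phi: the pressure is 0, attained at phi. *)

(** * The complex exponential and its first-order expansion at 0 *)

Section ComplexExponential.
Context {R : realType}.
Implicit Types z w : R[i].

Definition cexp (z : R[i]) : R[i] :=
  let: x +i* y := z in (expR x * cos y) +i* (expR x * sin y).

Lemma cexpD z w : cexp (z + w) = cexp z * cexp w.
Proof.
case: z w => [a b] [c d] /=; rewrite expRD cosD sinD.
by congr (_ +i* _); ring.
Qed.

Lemma normc_le_ReIm z (e : R) : `|complex.Re z| <= e -> `|complex.Im z| <= e ->
  `|z| <= (e *+ 2)%:C.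
Proof.
case: z => a b /= ae be; have e0 : 0 <= e by apply: le_trans ae.
rewrite normc_def /= lecR -(ler_pXn2r (n := 2)) ?nnegrE ?sqrtr_ge0 ?mulrn_wge0//.
rewrite sqr_sqrtr ?addr_ge0 ?sqr_ge0//.
move: ae be; rewrite !ler_norml => /andP[? ?] /andP[? ?]; nra.
Qed.

Lemma Re_le_normc z : `|complex.Re z| <= complex.Re `|z|.
Proof.
by case: z => a b /=; rewrite -sqrtr_sqr ler_wsqrtr// lerDl sqr_ge0.
Qed.

Lemma Im_le_normc z : `|complex.Im z| <= complex.Re `|z|.
Proof.
by case: z => a b /=; rewrite -sqrtr_sqr ler_wsqrtr// lerDr sqr_ge0.
Qed.

Lemma normc_ReE z : `|z| = (complex.Re `|z|)%:C.
Proof. by case: z. Qed.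

(** Multiplying the difference quotient by [x] clears the denominator, so the bound includes [x = 0]
    and can be combined for [expR], [cos] and [sin]. *)
Lemma is_derive_near0 (f : R -> R) (d : R) : is_derive (0 : R) 1 f d ->
  forall e, 0 < e -> \forall x \near (0:R), `|f x - f 0 - d * x| <= e * `|x|.
Proof.
move=> fd e e0.
have : (fun k : R => k^-1 *: (f (k *: 1 + 0) - f 0)) @ (0:R)^' --> d.
  rewrite -(@derive_val _ _ _ _ _ _ _ fd); exact: (@ex_derive _ _ _ _ _ _ _ fd).
move=> /cvgrPdist_le /(_ _ e0) => fe.
have := fe; rewrite near_withinE; apply: filterS => x.
have [->|x0] := eqVneq x 0; first by rewrite mulr0 !subrr normr0 mulr0.
move=> /(_ isT); rewrite /= addr0 [_ *: 1]mulr1 distrC => le_e.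
rewrite [X in `|X|](_ : _ = (x^-1 * (f x - f 0) - d) * x); last by field.
by rewrite normrM ler_pM2r ?normr_gt0.
Qed.

(* Only the derivative at 0 is needed: homogeneity makes the estimate uniform
   along [w * g] for bounded g. *)
Lemma cexp_near0 (e : R) : 0 < e -> exists2 r : R, 0 < r &
  forall z, `|z| < r%:C -> `|cexp z - 1 - z| <= e%:C * `|z|.
Proof.
(* Real and imaginary part of the remainder will each be at most [5 * e1 * n], with [n] the modulus
   of [z], and [normc_le_ReIm] doubles this, whence 10. The cap 1 keeps [expR x] below 3. *)
move=> e0; pose e1 := Num.min (e / 10) 1.
have e10 : 0 < e1 by rewrite lt_min divr_gt0/=.
have := is_derive_near0 (is_derive_expR 0) e10; rewrite expR0.
have := is_derive_near0 (is_derive_cos 0) e10; rewrite cos0 sin0 oppr0.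
have := is_derive_near0 (is_derive_sin 0) e10; rewrite sin0 cos0.
move=> s0 c0 x0.
have /nbhs_ballP[r /= r0 near0] : \forall x \near (0:R),
   [/\ `|expR x - 1 - x| <= e1 * `|x|, `|cos x - 1| <= e1 * `|x| &
    `|sin x - x| <= e1 * `|x|].
  apply: filterS3 s0 c0 x0 => x sx cx xx; split; move: sx cx xx.
  - by rewrite mul1r.
  - by rewrite mul0r !subr0.
  - by rewrite subr0 !mul1r.
(* Asking also for [n < e1] turns the quadratic term [(expR x - 1) * y], at most [2 * n * n], into
   at most [2 * e1 * n]. *)
exists (Num.min r e1); first by rewrite lt_min r0.
move=> z; rewrite normc_ReE ltcR lt_min => /andP[zr ze1].
have := Re_le_normc z; have := Im_le_normc z.
move: (complex.Re `|z|) zr ze1 => n zr ze1; case: z => x y /= yn xn.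
have [|ex _ _] := near0 x; first by rewrite /ball/= sub0r normrN (le_lt_trans xn).
have [|_ cy sy] := near0 y; first by rewrite /ball/= sub0r normrN (le_lt_trans yn).
have n0 : 0 <= n by apply: le_trans xn.
have le10 : e1 <= e / 10 by rewrite ge_min lexx.
have le11 : e1 <= 1 by rewrite ge_min lexx orbT.
have /andP[c1 c2] : -1 <= cos y <= 1 by rewrite cos_geN1 cos_le1.
have ex' : `|expR x - 1 - x| <= e1 * n by apply: le_trans ex _; rewrite ler_pM2l.
have cy' : `|cos y - 1| <= e1 * n by apply: le_trans cy _; rewrite ler_pM2l.
have sy' : `|sin y - y| <= e1 * n by apply: le_trans sy _; rewrite ler_pM2l.
have E3 : `|expR x| <= 3.
  move: ex' xn; rewrite !ler_norml => /andP[? ?] /andP[? ?]; nra.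
have E2 : `|expR x - 1| <= 2 * n.
  move: ex' xn; rewrite !ler_norml => /andP[? ?] /andP[? ?]; nra.
apply: (@le_trans _ _ ((5 * (e1 * n)) *+ 2)%:C); last first.
  by rewrite -rmorphM lecR; nra.
apply: normc_le_ReIm => /=.
- rewrite [X in `|X|](_ : _ = expR x * (cos y - 1) + (expR x - 1 - x)); last by ring.
  apply: le_trans (ler_normD _ _) _; rewrite normrM.
  have := ler_pM _ _ E3 cy'; rewrite !normr_ge0 => /(_ isT isT); nra.
- rewrite [X in `|X|](_ : _ = expR x * (sin y - y) + (expR x - 1) * y); last by ring.
  apply: le_trans (ler_normD _ _) _; rewrite !normrM.
  have := ler_pM _ _ E3 sy'; rewrite !normr_ge0 => /(_ isT isT).
  have := ler_pM _ _ E2 yn; rewrite !normr_ge0 => /(_ isT isT); nra.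
Qed.

End ComplexExponential.

(** * Positive functionals on C(X): Cauchy-Schwarz and Jensen inequalities *)

Lemma affine_ge0_eq0 (R : realType) (p q : R[i]) :
  (forall s : R, 0 <= p + s%:C * q) -> q = 0.
Proof.
case: p q => [p1 p2] [q1 q2] H.
have p20 : p2 = 0 by have := H 0; rewrite lecE /= => /andP[/eqP]; lra.
have q20 : q2 = 0 by have := H 1; rewrite lecE /= => /andP[/eqP]; lra.
apply/eqP; rewrite eq_complex /= q20 eqxx andbT; apply/negPn/negP => q10.
(* At this [s] the affine expression takes the value -1. *)
have := H (- (p1 + 1) / q1); rewrite lecE /= => /andP[_].
by rewrite mul0r subr0 mulfVK//; lra.
Qed.

Lemma conjcMr (R : realType) (s : R) (z : R[i]) :
  conjc (s%:C * z) = s%:C * conjc z.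
Proof. by case: z => a b; congr (_ +i* _); ring. Qed.

(** Concavity: [ln] lies below its tangent at [t]. This is [ln (1 + x) <= x] at [x = r / t - 1]. *)
Lemma ln_le_tangent (R : realType) (r t : R) : 0 < r -> 0 < t ->
  ln r <= (ln t - 1) + t^-1 * r.
Proof.
move=> r0 t0; have : ln (1 + (r / t - 1)) <= r / t - 1.
  by apply: le_ln1Dx; rewrite ltrBrDl subrr divr_gt0.
by rewrite addrC subrK ln_div// mulrC; lra.
Qed.

Section PositiveElements.
Context {R : realType} {X : ptopologicalType}.
Local Notation A := (cfun R X).
Implicit Types a b c d : A.

Definition rcfun (f : X -> R) (f_cts : continuous f) : A :=
  Cfun (complex_cts f_cts (fun y => cvg_cst (0 : R))).

(** The pointwise square root is continuous and serves as the factor [y]; conversely [star y * y]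
    has the values [|y x|^2]. *)
Lemma positive_eltP a : positive_elt a <-> forall x, 0 <= a x.
Proof.
split=> [[y ->] x|a0].
  by rewrite cfunME cfun_starE mulrC mulcJ_ge0.
have sq_cts : continuous (fun x => Num.sqrt (complex.Re (a x))).
  move=> x; apply: (@continuous_comp X R R); last exact: sqrt_continuous.
  exact: (@Re_cts _ _ _ (@cfun_cts _ _ a) x).
exists (rcfun sq_cts); apply: cfunP => x; rewrite cfunME cfun_starE /=.
have := a0 x; case: (a x) => p q; rewrite lecE/= => /andP[/eqP -> p0].
rewrite oppr0; apply/eqP; rewrite eq_complex/= !mulr0 !mul0r !subr0 addr0 eqxx.
by rewrite -expr2 sqr_sqrtr// eqxx.
Qed.

Section Functional.
Context (l : A -> R[i]) (l_lin : scalar l)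
  (l_pos : forall a, positive_elt a -> 0 <= l a).

HB.instance Definition _ := GRing.isLinear.Build _ _ _ _ l l_lin.

Lemma functional_le a b : (forall x, a x <= b x) -> l a <= l b.
Proof.
move=> ab; rewrite -subr_ge0 -linearB; apply/l_pos/positive_eltP => x.
by rewrite -[_ x]/(b x - a x) subr_ge0.
Qed.

(* Cauchy-Schwarz for [1] and [d]: expand [star (1 + t d) * (1 + t d) >= 0] and
   let the scalar [t] be arbitrarily large. *)
Lemma functional_null d : l (star d * d) = 0 -> l d = 0.
Proof.
move=> ld0.
have expand (t : R[i]) : 0 <= l 1 + t * l d + conjc t * l (star d).
  have := l_pos (ex_intro _ (1 + t *: d) erefl).
  rewrite [star _ * _](_ : _ = 1 + t *: d + conjc t *: star d +
      (conjc t * t) *: (star d * d)).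
    by rewrite !linearD/= !linearZ/= ld0 mulr0 addr0.
  apply: cfunP => x; rewrite cfunME cfun_starE !cfunDE !cfunZE cfunME !cfun_starE cfun1E.
  rewrite (rmorphD (@conjc R)) (rmorphM (@conjc R)) (rmorph1 (@conjc R)); ring.
have ge (t : R[i]) (s : R) : 0 <= l 1 + s%:C * (t * l d + conjc t * l (star d)).
  have := expand (s%:C * t); rewrite conjcMr; congr (_ <= _); ring.
have eq0 (t : R[i]) : t * l d + conjc t * l (star d) = 0.
  by apply: affine_ge0_eq0; exact: ge.
(* The choice [t = 1] gives [l (star d) = - l d]; then [t = 'i] leaves twice ['i * l d] equal to
   0. *)
have w := eq0 1; rewrite conjc1 !mul1r in w.
have := eq0 'i%C; rewrite -[l (star d)](addKr (l d)) w addr0 mulrN.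
rewrite -mulrBl => /eqP; rewrite mulf_eq0 => /orP[/eqP/(congr1 (@complex.Im R))|/eqP//].
rewrite /= => im2; have : (0 : R) = 1 by lra.
by move/eqP; rewrite eq_sym oner_eq0.
Qed.

Hypothesis l1 : l 1 = 1.

(** The functional is applied to the tangent bound for [ln]. The point of tangency stays free: one
    choice proves [0 < l a], another gives Jensen. *)
Lemma functional_ln_tangent a (t : R) : strictly_positive a -> 0 < t ->
  l (cfun_ln a) <= (ln t - 1 + t^-1 * complex.Re (l a))%:C.
Proof.
move=> a0 t0.
have -> : (ln t - 1 + t^-1 * complex.Re (l a))%:C =
    l ((ln t - 1)%:C *: 1 + (t^-1)%:C *: a).
  rewrite linearD/= !linearZ/= l1 [_ * 1]mulr1.
  have : 0 <= l a by apply/l_pos/positive_eltP => x; exact: ltW.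
  case: (l a) => p q; rewrite lecE/= => /andP[/eqP -> _].
  by rewrite rmorphD rmorphM.
apply: functional_le => x; rewrite cfun_lnE// cfunDE !cfunZE cfun1E mulr1.
have := ln_le_tangent (Re_gt0 x a0) t0; have := a0 x.
case: (a x) => p q; rewrite ltcE/= => /andP[/eqP -> p0].
by rewrite -rmorphM -rmorphD lecR.
Qed.

Lemma functional_gt0 a : strictly_positive a -> 0 < l a.
Proof.
move=> a0; have la0 : 0 <= l a by apply/l_pos/positive_eltP => x; exact: ltW.
rewrite lt_def la0 andbT; apply/eqP => la.
(* If [l a = 0], the bound reads [l (cfun_ln a) <= ln t - 1]; this [t] makes the right side one less
   than the left. *)
have := functional_ln_tangent a0 (expR_gt0 (complex.Re (l (cfun_ln a)))).
rewrite la mulr0 addr0 expRK; case: (l (cfun_ln a)) => p q /=.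
by rewrite lecE/= lerBrDr gerDl ler10 andbF.
Qed.

Lemma functional_jensen a : strictly_positive a ->
  l (cfun_ln a) <= (ln (complex.Re (l a)))%:C.
Proof.
move=> a0; have la0 : 0 < complex.Re (l a).
  by have := functional_gt0 a0; case: (l a) => p q; rewrite ltcE => /andP[].
(* With tangency at [t = l a] the linear term is 1 and cancels the -1. *)
have := functional_ln_tangent a0 la0.
by rewrite mulVf ?gt_eqF// subrK.
Qed.

End Functional.
End PositiveElements.

Lemma cfun_sumE (R : realType) (X : ptopologicalType) (I : Type) (r : seq I)
    (f : I -> cfun R X) x : (\sum_(i <- r) f i) x = \sum_(i <- r) f i x.
Proof. by elim/big_rec2: _ => // i a b _ <-. Qed.

(** * Fibres of a local homeomorphism *)

Section LocalHomeomorphism.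
Context {X : ptopologicalType} {T : X -> X}.
Hypotheses (X_compact : compact [set: X]) (X_hausdorff : hausdorff_space X)
  (T_homeo : local_homeomorphism T).

Lemma local_homeomorphism_continuous : continuous T.
Proof.
move=> x; have [U [_ Ux _ T_cts _]] := T_homeo x.
by apply: T_cts; rewrite inE.
Qed.

Lemma point_closed (x : X) : closed [set x].
Proof. exact/accessible_closed_set1/hausdorff_accessible. Qed.

(** The fibre is compact, and each open set on which [T] is injective meets it in at most one point;
    finitely many such sets cover it. *)
Lemma fibre_finite x : finite_set [set y | T y = x].
Proof.
have fib_closed : closed [set y | T y = x].
  have /continuous_closedP/(_ _ (@point_closed x)) := local_homeomorphism_continuous.
  by [].
have : compact [set y | T y = x].
  exact: (subclosed_compact fib_closed X_compact).
have [U UP] := choice T_homeo.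
rewrite compact_cover => /(_ X [set: X] U)[].
- by move=> y _; have [] := UP y.
- by move=> y _; exists y => //; have [] := UP y.
move=> D _ fib_cover.
suff : finite_set (\bigcup_(y in [set` D]) (U y `&` [set z | T z = x])).
  apply: sub_finite_set => z zx.
  by have [y Dy Uz] := fib_cover z zx; exists y.
apply: bigcup_finite => // y _.
have [[z [Uz zx]]|no] := pselect (exists z, U y z /\ T z = x); last first.
  by apply: (sub_finite_set (B := set0)) => // z [? ?]; case: no; exists z.
apply: (sub_finite_set (B := [set z])) => // w [Uw wx].
have [_ _ T_inj _ _] := UP y.
by apply: T_inj; rewrite ?inE// wx.
Qed.

End LocalHomeomorphism.

(** * Transfer operators: dependence on fibres, and the index as a weight *)

Section TransferOperator.
Context {R : realType} {X : ptopologicalType} {T : X -> X}.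
Local Notation A := (cfun R X).
Implicit Types a b c d : A.
Hypotheses (X_compact : compact [set: X]) (X_hausdorff : hausdorff_space X)
  (T_homeo : local_homeomorphism T).
Variable L : A -> A.
Hypotheses (L_transfer : transfer_operator T L) (L1 : L 1 = 1).

Lemma urysohn_cfun (F G : set X) : closed F -> closed G -> F `&` G = set0 ->
  exists e : A, [/\ forall x, F x -> e x = 0, forall x, G x -> e x = 1 &
    forall x, 0 <= e x <= 1].
Proof.
move=> F_closed G_closed FG0.
have [f [f_cts f0 f1 f01]] := urysohn_ext_itv (compact_normal X_hausdorff X_compact)
  F_closed G_closed FG0 (@ltr01 R).
exists (rcfun f_cts); split=> x /=.
- by move=> Fx; congr (_ +i* _); apply: f0; exists x.
- by move=> Gx; congr (_ +i* _); apply: f1; exists x.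
- have /f01 : range f (f x) by exists x.
  by rewrite /= in_itv/= !lecE/= eqxx.
Qed.

Let L_lin : linear L. Proof. by case: L_transfer. Qed.

HB.instance Definition _ := GRing.isLinear.Build R[i] A A _ L L_lin.

Let LZ k a : L (k *: a) = k *: L a.
Proof. exact: (linearZZ L). Qed.

(** Evaluation at a point makes [L] a positive functional, to which the preceding section
    applies. *)
Let ev x (a : A) : R[i] := L a x.

Let ev_lin x : scalar (ev x).
Proof. by move=> k a b; rewrite /ev L_lin. Qed.

Let ev_pos x a : positive_elt a -> 0 <= ev x a.
Proof. by case: L_transfer => _ L_pos _ /L_pos/positive_eltP; apply. Qed.

(* Multiplying [c] by [alpha b], with [b x = 1] and [b = 0] on the image of
   [{c >= e}], leaves [L c x] unchanged and makes [c] smaller than [e]. *)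
Lemma transfer_null_ge0 c x : (forall y, 0 <= c y) ->
  (forall y, T y = x -> c y = 0) -> L c x = 0.
Proof.
move=> c0 cx; have T_cts := local_homeomorphism_continuous T_homeo.
have Lc0 : 0 <= L c x by apply: ev_pos; apply/positive_eltP.
apply/eqP; rewrite eq_le Lc0 andbT.
have [_ _ L_mod] := L_transfer.
suff small (e : R) : 0 < e -> L c x <= e%:C.
  move: Lc0 small; case: (L c x) => p q; rewrite lecE/= => /andP[/eqP -> p0] small.
  rewrite lecR; apply/ler_addgt0Pl => e /small; rewrite lecR addr0; exact.
move=> e0; pose K := [set y | e <= complex.Re (c y)].
have K_closed : closed K.
  have /continuous_closedP/(_ _ (@closed_ge R e)) := Re_cts (@cfun_cts _ _ c).
  by [].
have TK_closed : closed (T @` K).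
  apply: compact_closed => //; apply: continuous_compact.
    exact: continuous_subspaceT.
  exact: (subclosed_compact K_closed X_compact).
have [|b [b0 b1 b01]] := urysohn_cfun TK_closed (point_closed X_hausdorff (x := x)).
  rewrite -subset0 => _ [[y Ky <-] yx]; move: Ky; rewrite /K/= cx//=.
  by rewrite leNgt e0.
have -> : L c x = L (alpha T b * c) x by rewrite L_mod cfunME b1// mul1r.
have -> : e%:C = ev x (e%:C *: 1).
  by rewrite /ev LZ L1 cfunZE mulr1.
apply: (functional_le (ev_lin x) (@ev_pos x)) => y.
rewrite cfunME alphaE// cfunZE cfun1E mulr1.
have [Ky|nKy] := pselect (K y).
  by rewrite b0 ?mul0r ?lecR ?(ltW e0)//; exists y.
have : complex.Re (c y) < e by rewrite ltNge; apply/negP.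
have /andP[] := b01 (T y); have := c0 y.
case: (c y) => p q; case: (b (T y)) => r s; rewrite !lecE/=.
move=> /andP[/eqP -> ?] /andP[/eqP -> ?] /andP[_ ?] ?.
by rewrite !mulr0 mul0r addr0 subr0 eqxx/=; nra.
Qed.

(** The nonnegative case applies to [star (c - d) * (c - d)], and Cauchy-Schwarz passes from there
    to [c - d]. *)
Lemma transfer_fibre_local c d x : (forall y, T y = x -> c y = d y) -> L c x = L d x.
Proof.
move=> cd; apply/eqP; rewrite -subr_eq0; apply/eqP.
have -> : L c x - L d x = ev x (c - d).
  by rewrite /ev linearB.
apply: (functional_null (ev_lin x) (@ev_pos x)).
apply: transfer_null_ge0 => y.
  by rewrite cfunME cfun_starE mulrC mulcJ_ge0.
by move=> yx; rewrite cfunME -[(c - d) y]/(c y - d y) cd// subrr mulr0.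
Qed.

Context {m : nat} {u : 'I_m -> A}.
Hypothesis (u_basis : quasi_basis (alpha T \o L) u).

Let quasi_basisE a y : a y = \sum_(i < m) u i y * L (star (u i) * a) (T y).
Proof.
rewrite {1}(u_basis a) cfun_sumE; apply: eq_bigr => i _.
by rewrite cfunME/= alphaE//; exact: local_homeomorphism_continuous.
Qed.

Lemma indE y : ind u y = \sum_(i < m) `|u i y| ^+ 2.
Proof.
by rewrite cfun_sumE; apply: eq_bigr => i _; rewrite cfunME cfun_starE sqr_normc.
Qed.

(** If every [u i] vanished at [y], so would the quasi-basis expansion of 1. *)
Lemma ind_gt0 : strictly_positive (ind u).
Proof.
move=> y; rewrite indE lt_def sumr_ge0 ?andbT => [|i _]; last exact: exprn_ge0.
apply/negP; rewrite psumr_eq0 => [/allP u0|i _]; last exact: exprn_ge0.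
have := quasi_basisE 1 y; rewrite big1 => [/eqP|i _]; first by rewrite cfun1E oner_eq0.
have /eqP := u0 i (mem_index_enum i).
by rewrite /= => /eqP; rewrite expf_eq0/= normr_eq0 => /eqP ->; rewrite mul0r.
Qed.

(** On the fibre through [y], [star (u i) * e] agrees with the scalar multiple [conjc (u i y) *: e].
    Expanding [e] in the quasi-basis at [y] thus gives [1 = ind u y * L e (T y)]. *)
Lemma transfer_indicator (e : A) y : e y = 1 ->
  (forall z, T z = T y -> z != y -> e z = 0) -> L e (T y) = (ind u y)^-1.
Proof.
move=> ey e0; have ind0 : ind u y != 0 by rewrite gt_eqF// ind_gt0.
apply: (mulfI ind0); rewrite divff// -ey [in RHS]quasi_basisE indE mulr_suml.
apply: eq_bigr => i _.
have -> : L (star (u i) * e) (T y) = L (conjc (u i y) *: e) (T y).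
  apply: transfer_fibre_local => z zy; rewrite cfunME cfun_starE cfunZE.
  by have [->//|/e0 ->//] := eqVneq z y; rewrite !mulr0.
by rewrite LZ cfunZE mulrA sqr_normc.
Qed.

(** Urysohn functions separate the points of the finite fibre, so there [ind u * c] is a combination
    of indicators. The indicator of [y] contributes [ind u y * c y] divided by [ind u y]. *)
Lemma transfer_fibre_sum c x :
  L (ind u * c) x = \sum_(y \in [set y | T y = x]) c y.
Proof.
have fin := fibre_finite X_compact X_hausdorff T_homeo x.
have /choice[e eP] : forall y, exists e : A, T y = x -> e y = 1 /\
    forall z, T z = x -> z != y -> e z = 0.
  move=> y.
  have F_closed : closed [set z | T z = x /\ z != y].
    have /accessible_finite_set_closed := hausdorff_accessible X_hausdorff.
    by apply; apply: sub_finite_set fin => z [].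
  have [|e [e0 e1 _]] := urysohn_cfun F_closed (point_closed X_hausdorff (x := y)).
    by rewrite -subset0 => z [[_ /eqP zy] ?].
  by exists e => _; split; [exact: e1|move=> z zx zy; exact: e0].
rewrite fsbig_finite//; set s := finmap.enum_fset _.
have sE y : (y \in s) = (y \in [set y | T y = x]) by rewrite in_fset_set.
rewrite (@transfer_fibre_local _ (\sum_(y <- s) (ind u * c) y *: e y)).
  rewrite linear_sum cfun_sumE big_seq [RHS]big_seq; apply: eq_bigr => y.
  rewrite sE inE => /= yx; rewrite LZ cfunZE -yx.
  have [ey ez] := eP y yx.
  rewrite transfer_indicator ?yx// mulrAC divff ?mul1r//.
  by rewrite gt_eqF// ind_gt0.
move=> z zx; rewrite cfun_sumE (bigD1_seq z) ?sE ?inE//; last exact: finmap.fset_uniq.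
have [ez _] := eP z zx; rewrite cfunZE ez mulr1 big1_seq => [|y]; first by rewrite /= addr0.
rewrite sE => /andP[yz]; rewrite inE => yx; have [_ ey] := eP y yx.
by rewrite cfunZE ey ?mulr0// eq_sym.
Qed.

(** The fibre sums are the values of an element of C(X), so [mkcfun] does not fall back on its
    default 0. *)
Lemma transferE (rho0 a : A) : transfer T rho0 a = L (ind u * (rho0 * a)).
Proof.
have E : (fun x => \sum_(y \in [set y | T y = x]) rho0 y * a y : Cplx R) =
    L (ind u * (rho0 * a)).
  by apply/funext => x; rewrite transfer_fibre_sum.
by apply: cfunP => x; rewrite /transfer E mkcfunE//; exact: cfun_cts.
Qed.

End TransferOperator.

(** * The entire extension of the orbit of [S] *)

Lemma norm_Re (R : realType) (V : normedModType R[i]) (v : V) :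
  `|v| = (complex.Re `|v|)%:C.
Proof.
have := normr_ge0 v; case: `|v| => p q.
by rewrite lecE/= => /andP[/eqP -> _].
Qed.

Section ContinuousExponential.
Context {R : realType} {X : ptopologicalType}.
Local Notation A := (cfun R X).
Variables (g : X -> R) (g_cts : continuous g).

Fact expi_cts (z : R[i]) : continuous ((fun x => cexp ('i * z * (g x)%:C)) : X -> Cplx R).
Proof.
case: z => a b.
have -> : (fun x => cexp ('i * (a +i* b) * (g x)%:C)) =
    (fun x => (expR (- b * g x) * cos (a * g x)) +i* (expR (- b * g x) * sin (a * g x))).
  apply/funext => x.
  have -> : 'i * (a +i* b) * (g x)%:C = (- b * g x) +i* (a * g x).
    by apply/eqP; rewrite eq_complex/=; apply/andP; split; apply/eqP; ring.
  by [].
have lin_cts (k : R) : continuous (fun x => k * g x).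
  by move=> x; apply: cvgM; [exact: cvg_cst|exact: g_cts].
apply: complex_cts => x; apply: cvgM; apply: (@continuous_comp X R R).
- exact: lin_cts.
- exact: continuous_expR.
- exact: lin_cts.
- exact: continuous_cos.
- exact: lin_cts.
- exact: continuous_expR.
- exact: lin_cts.
- exact: continuous_sin.
Qed.

(** This is [exp(i z g)]; for [g = ln h] it interpolates between [h^(i t)] at real [z = t] and
    [h^(-beta)] at [z = i beta]. *)
Definition expi (z : R[i]) : A := Cfun (@expi_cts z).

Lemma expiD z w : expi (z + w) = expi z * expi w.
Proof.
by apply: cfunP => x; rewrite cfunME /= -cexpD; congr cexp; ring.
Qed.

Variable (M : R).
Hypotheses (M0 : 0 < M) (gM : forall x, `|g x| <= M).

(** The expansion of [cexp] at ['i * w * g x] is uniform in [x] because [g] is bounded: tolerance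
    [e / M] and radius [r / M] absorb the factor [M]. *)
Lemma expi_near0 (e : R) : 0 < e -> exists2 r : R, 0 < r &
  forall w : R[i], `|w| < r%:C ->
  forall x, `|(expi w - 1 - (w * 'i) *: rcfun g_cts) x| <= e%:C * `|w|.
Proof.
move=> e0; have [|r r0 rP] := @cexp_near0 R (e / M); first exact: divr_gt0.
exists (r / M) => [|w wr x]; first exact: divr_gt0.
have n : `|'i * w * (g x)%:C| = `|w| * `|g x|%:C.
  rewrite !normrM (normc_def 'i) (normc_def (g x)%:C)/=.
  by rewrite !expr0n expr1n/= addr0 add0r sqrtr1 mul1r sqrtr_sqr.
have := rP ('i * w * (g x)%:C).
rewrite n => H.
have {H} := H _; rewrite -[(expi w - 1 - _) x]/(cexp ('i * w * (g x)%:C) - 1 - w * 'i * (g x)%:C).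
rewrite [w * 'i]mulrC => H; apply: le_trans (H _) _.
  move: wr; rewrite (normc_ReE w) -rmorphM !ltcR ltr_pdivlMr//; apply: le_lt_trans.
  by rewrite ler_wpM2l//; have := normr_ge0 w; rewrite normc_ReE lecR.
rewrite (normc_ReE w) -!rmorphM lecR.
have : 0 <= complex.Re `|w| by have := normr_ge0 w; rewrite normc_ReE lecR.
move: (complex.Re _) => n' n'0.
rewrite [leRHS](_ : _ = e / M * (n' * M)); last by field; rewrite gt_eqF.
apply: ler_wpM2l; first by rewrite divr_ge0 ?ltW.
exact: ler_wpM2l.
Qed.

End ContinuousExponential.

(* Stated in an abstract module: [B] carries two scalings, as an algebra and as
   a normed module, which are convertible but block rewriting. *)
Lemma diff_quotient (K : fieldType) (V : lmodType K) (w k : K) (y v : V) : w != 0 ->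
  k *: y - w^-1 *: v = - (w^-1 *: (v - (w * k) *: y)).
Proof.
by move=> w0; rewrite -(opprB _ v) scalerN opprK scalerBr scalerA mulrA mulVf// mul1r.
Qed.

Section EntireOrbit.
Context {R : realType} {X : ptopologicalType} {B : cstarAlgType R}.
Local Notation A := (cfun R X).
Variables (j : A -> B) (S : B).
Hypotheses (j_morph : star_morphism j)
  (j_le : forall (a : A) (e : R), (forall x, `|a x| <= e%:C) -> `|j a| <= e%:C).
Variables (g : X -> R) (g_cts : continuous g) (M : R).
Hypotheses (M0 : 0 < M) (gM : forall x, `|g x| <= M).

Let jL : linear j. Proof. by case: j_morph. Qed.

HB.instance Definition _ := GRing.isLinear.Build R[i] A B _ j jL.

Let jB (a b : A) : j (a - b) = j a - j b. Proof. exact: linearB. Qed.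
Let jZ k (a : A) : j (k *: a) = k *: j a. Proof. exact: (linearZZ j). Qed.
Let j1 : j 1 = 1. Proof. by case: j_morph => _ []. Qed.
Let jM (a b : A) : j (a * b) = j a * j b. Proof. by case: j_morph => _ [_]. Qed.

(* [cfun R X] has no norm instance, so the difference quotient is estimated
   pointwise and carried to [B] by the contraction [j]. *)
Lemma entire_expi : entire (fun z => j (expi g_cts z) * S).
Proof.
move=> z; rewrite /derivable.
pose D := j (expi g_cts z * ('i%C *: rcfun g_cts)) * S.
suff : (fun w : Cplx R => w^-1 *: ((j (expi g_cts (w *: 1 + z)) * S) -
   j (expi g_cts z) * S)) @ (0:Cplx R)^' --> D by apply: cvgP.
apply/cvgrPdist_le => eps eps0.
have [e e0 ->] : exists2 e : R, 0 < e & eps = e%:C.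
  move: eps0; case: eps => p q; rewrite ltcE/= => /andP[/eqP -> p0].
  by exists p.
(* The outer factors of the remainder have norms with product [k]; dividing by [k + 1] stays
   legitimate when [k = 0]. *)
pose k := complex.Re `|j (expi g_cts z)| * complex.Re `|S|.
have k0 : 0 <= k.
  by apply: mulr_ge0; rewrite -lecR -norm_Re normr_ge0.
have k1 : 0 < k + 1 by rewrite ltr_wpDl.
have [|r r0 rP] := @expi_near0 _ _ _ g_cts M M0 gM (e / (k + 1)).
  exact: divr_gt0.
rewrite near_withinE; apply/nbhs_ballP; exists r%:C => /=; first by rewrite ltcR.
move=> w; rewrite /ball/= sub0r normrN => wr w0.
(* The exponential law factors out [expi g_cts z], which leaves the remainder of the expansion at
   0. *)
have -> : D - w^-1 *: (j (expi g_cts (w *: 1 + z)) * S - j (expi g_cts z) * S) =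
  - (w^-1 *: (j (expi g_cts z) * j (expi g_cts w - 1 - (w * 'i) *: rcfun g_cts) * S)).
  have -> : w *: 1 + z = z + w by rewrite addrC [_ *: 1]mulr1.
  rewrite expiD /D jM jZ jM !jB jZ j1 -scalerAr -!scalerAl mulrBr mulrBl mulrBr mulrBl.
  rewrite mulr1 -scalerAr -scalerAl; set Y := _ * j (rcfun _) * S; set V := _ - j _ * S.
  exact: diff_quotient.
rewrite normrN normrZ.
have jn : `|j (expi g_cts w - 1 - (w * 'i) *: rcfun g_cts)| <=
    (e / (k + 1) * complex.Re `|w|)%:C.
  by apply: j_le => x; have := rP w wr x; rewrite (normc_ReE w) -rmorphM.
apply: (@le_trans _ _ (`|w^-1| * ((k * (e / (k + 1) * complex.Re `|w|))%:C))).
  apply: ler_wpM2l; first exact: normr_ge0.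
  apply: le_trans (cs_normM _ _) _.
  apply: (@le_trans _ _ (`|j (expi g_cts z)| * (e / (k + 1) * complex.Re `|w|)%:C * `|S|)).
    apply: ler_wpM2r; first exact: normr_ge0.
    apply: le_trans (cs_normM _ _) _.
    by apply: ler_wpM2l; first exact: normr_ge0.
  by rewrite (norm_Re (j _)) (norm_Re S) -!rmorphM lecR /k mulrAC.
rewrite normfV (normc_ReE w) -fmorphV -rmorphM lecR.
have nw0 : 0 < complex.Re `|w|.
  by have := normr_gt0 w; rewrite w0 normc_ReE ltcR.
rewrite [leLHS](_ : _ = e * (k / (k + 1))); last first.
  by field; rewrite !gt_eqF.
by rewrite ler_piMr ?(ltW e0)// ler_pdivrMr// mul1r lerDl.
Qed.

End EntireOrbit.

(** * Relations in the crossed product and the KMS condition *)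

Section CrossedProduct.
Context {R : realType} {X : ptopologicalType} {T : X -> X}.
Local Notation A := (cfun R X).
Variable L : A -> A.
Context {B : cstarAlgType R} {j : A -> B} {S : B}.
Hypothesis (BP : is_crossed_product T L j S).

Lemma crossed_product_star_morphism : star_morphism j.
Proof.
have [D [iota [S0 [q [[[[iL [i1 iM] iS] _ _] _ _ _]
  [[qL [q1 qM] qS] _ _ _] jE _]]]]] := BP.
split=> [k a b||a]; last by rewrite !jE iS qS.
- by rewrite !jE iL qL.
- by split=> [|a b]; rewrite !jE ?i1 ?q1// iM qM.
Qed.

Lemma crossed_product_transfer a : star S * j a * S = j (L a).
Proof.
have [D [iota [S0 [q [[[_ _ iL] _ _ _] [[_ [q1 qM] qS] _ _ _] jE SE]]]]] := BP.
by rewrite SE !jE -iL !qM qS.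
Qed.

(** The quotient norm is at most the norm of the representative [iota a], as 0 lies in the ideal,
    and [iota] preserves the sup norm. *)
Lemma crossed_product_norm_le (a : A) (e : R) :
  (forall x, `|a x| <= e%:C) -> `|j a| <= e%:C.
Proof.
move=> ae.
have [D [iota [S0 [q [[_ iN _ _] [_ _ _ qN] jE _]]]]] := BP.
rewrite norm_Re lecR jE -[leLHS]/(rnorm _) qN.
apply: (@le_trans _ _ (rnorm (iota a))).
  apply: ge_inf; last first.
    exists 0; last by rewrite addr0.
    by move=> J [[_ J0 _ _] _].
  by exists 0 => _ [k _ <-]; rewrite /rnorm -lecR -norm_Re normr_ge0.
rewrite iN; apply: ge_sup; first by exists (complex.Re `|a point|); exists point.
by move=> _ [x _ <-]; rewrite -lecR -normc_ReE.
Qed.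

Variables (h : A) (beta : R) (m : nat) (u : 'I_m -> A) (F : B -> A)
  (sigma : R -> B -> B) (phi : A -> R[i]).
Hypotheses (X_compact : compact [set: X]) (h_gt0 : strictly_positive h)
  (FP : canonical_expectation T (ind u) j S F) (sigmaP : dynamics h j S sigma)
  (phi_kms : kms_state sigma beta (phi \o F)) (u_gt0 : strictly_positive (ind u)).

(* The KMS condition for [S] and [star S * j (ind u * a)]. *)
Lemma kms_transfer_invariant a : phi (L (cfun_pow h (- beta) * ind u * a)) = phi a.
Proof.
have [[_ _ Fj _] FS] := FP; have [_ _ sigmaS] := sigmaP; have [_ kms] := phi_kms.
have g_cts := ln_cts h_gt0.
(* Compactness of [X] bounds the continuous function [ln h]. *)
have [M M0 gM] : exists2 M : R, 0 < M & forall x, `|ln (complex.Re (h x))| <= M.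
  have K_compact : compact ((fun x => ln (complex.Re (h x))) @` [set: X]).
    by apply: continuous_compact => //; exact: continuous_subspaceT.
  have [M [_ HM]] := compact_bounded K_compact.
  exists (`|M| + 1) => [|x]; first by rewrite ltr_wpDl.
  by apply: HM; [rewrite (le_lt_trans (ler_norm _)) ?ltrDl|exists x].
have f_entire := entire_expi (S := S) crossed_product_star_morphism
  crossed_product_norm_le M0 gM (g_cts := g_cts).
have [jL [j1 jM] _] := crossed_product_star_morphism.
have f_real t : j (expi g_cts t%:C) * S = sigma t S.
  rewrite sigmaS; congr (j _ * S); apply: cfunP => x; rewrite cfun_ipowE//.
  have -> : expi g_cts t%:C x = cexp (0 +i* (t * ln (complex.Re (h x)))).
    by congr cexp; apply/eqP; rewrite eq_complex/=; apply/andP; split; apply/eqP; ring.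
  by rewrite /= expR0 !mul1r.
have := kms S (star S * j (ind u * a)) _ f_entire f_real.
have -> : expi g_cts (0 +i* beta) = cfun_pow h (- beta).
  apply: cfunP => x; rewrite cfun_powE// /powR gt_eqF ?Re_gt0//.
  have -> : expi g_cts (0 +i* beta) x = cexp (- beta * ln (complex.Re (h x)))%:C.
    by congr cexp; apply/eqP; rewrite eq_complex/=; apply/andP; split; apply/eqP; ring.
  by rewrite /= cos0 sin0 mulr1 mulr0.
have ind0 y : ind u y != 0 by rewrite gt_eqF.
have -> : (phi \o F) (S * (star S * j (ind u * a))) = phi a.
  (* For [n = m = 1] the weight in the formula for [F] is the inverse of [ind u], which cancels the
     factor [ind u] placed in [y]. *)
  have := FS 1 (ind u * a) 1 1; rewrite /= j1 !mul1r !expr1 -(mulrA S) => ->.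
  rewrite big_ord_recl big_ord0 mulr1; congr phi; apply: cfunP => x.
  by rewrite !cfunME cfun_invE// mulKf.
move=> ->; congr phi.
have -> : star S * j (ind u * a) * (j (cfun_pow h (- beta)) * S) =
    j (L (cfun_pow h (- beta) * ind u * a)).
  by rewrite -crossed_product_transfer !mulrA -[_ * _ * j _]mulrA -jM mulrC mulrA.
by rewrite Fj.
Qed.

End CrossedProduct.

(** * Logarithms of strictly positive functions *)

Section Logarithm.
Context {R : realType} {X : ptopologicalType}.
Local Notation A := (cfun R X).
Implicit Types a b : A.

Lemma strictly_positive_Re a x : strictly_positive a -> a x = (complex.Re (a x))%:C.
Proof. by move/(_ x); case: (a x) => p q; rewrite ltcE/= => /andP[/eqP ->]. Qed.

Lemma strictly_positiveM a b :
  strictly_positive a -> strictly_positive b -> strictly_positive (a * b).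
Proof. by move=> a0 b0 x; rewrite cfunME mulr_gt0. Qed.

Lemma strictly_positive_inv a : strictly_positive a -> strictly_positive (cfun_inv a).
Proof.
by move=> a0 x; rewrite cfun_invE ?invr_gt0// => y; rewrite gt_eqF.
Qed.

Lemma strictly_positive_pow a s : strictly_positive a -> strictly_positive (cfun_pow a s).
Proof. by move=> a0 x; rewrite cfun_powE// ltcR powR_gt0// Re_gt0. Qed.

Lemma mulr_cfun_inv a : strictly_positive a -> a * cfun_inv a = 1.
Proof.
move=> a0; apply: cfunP => x; rewrite cfunME cfun_invE => [|y]; last by rewrite gt_eqF.
by rewrite divff// gt_eqF.
Qed.

Lemma cfun_lnM a b : strictly_positive a -> strictly_positive b ->
  cfun_ln (a * b) = cfun_ln a + cfun_ln b.
Proof.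
move=> a0 b0; have ab0 := strictly_positiveM a0 b0; apply: cfunP => x.
rewrite (cfun_lnE x ab0).
have := cfun_lnE x b0; have := cfun_lnE x a0.
move: (cfun_ln a) (cfun_ln b) => lna lnb lnaE lnbE.
rewrite cfunDE lnaE lnbE.
have -> : complex.Re ((a * b) x) = complex.Re (a x) * complex.Re (b x).
  rewrite cfunME {1}(strictly_positive_Re x a0) {1}(strictly_positive_Re x b0).
  by rewrite /= mulr0 subr0.
by rewrite lnM ?posrE ?Re_gt0// rmorphD.
Qed.

Lemma cfun_ln1 : cfun_ln (1 : A) = 0.
Proof. by apply: cfunP => x; rewrite cfun_lnE ?cfun1E/= ?ln1// => y; rewrite ltr01. Qed.

Lemma cfun_lnV a : strictly_positive a -> cfun_ln (cfun_inv a) = - cfun_ln a.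
Proof.
move=> a0; apply/eqP; rewrite -addr_eq0 addrC -cfun_lnM//; last exact: strictly_positive_inv.
by rewrite mulr_cfun_inv// cfun_ln1.
Qed.

Lemma cfun_ln_div a b : strictly_positive a -> strictly_positive b ->
  cfun_ln (a * cfun_inv b) = cfun_ln a - cfun_ln b.
Proof.
by move=> a0 b0; rewrite (cfun_lnM a0 (strictly_positive_inv b0)) (cfun_lnV b0).
Qed.

End Logarithm.

(** * Entropy bounds and the equilibrium property *)

Lemma scalarB (R : realType) (V : lmodType R[i]) (f : V -> R[i]) (v w : V) :
  scalar f -> f (v - w) = f v - f w.
Proof. by move=> f_lin; rewrite addrC -scaleN1r f_lin mulN1r addrC. Qed.

Lemma scalarN (R : realType) (V : lmodType R[i]) (f : V -> R[i]) (v : V) :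
  scalar f -> f (- v) = - f v.
Proof.
move=> f_lin; have f0 : f 0 = 0 by rewrite -(subrr 0) scalarB// subrr.
by rewrite -sub0r scalarB// f0 sub0r.
Qed.

Section Equilibrium.
Context {R : realType} {X : ptopologicalType} {T : X -> X}.
Local Notation A := (cfun R X).
Context {L : A -> A} {m : nat} {u : 'I_m -> A}.
Hypotheses (X_compact : compact [set: X]) (X_hausdorff : hausdorff_space X)
  (T_homeo : local_homeomorphism T) (L_transfer : transfer_operator T L)
  (L1 : L 1 = 1) (u_basis : quasi_basis (alpha T \o L) u).
Variables (b rho0 : A).
Hypotheses (b_gt0 : strictly_positive b) (rho0_gt0 : strictly_positive rho0)
  (b_norm : L (b * ind u) = 1).

Let tE (a : A) : transfer T rho0 a = L (ind u * (rho0 * a)).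
Proof. exact: transferE. Qed.

Let i_gt0 : strictly_positive (ind u).
Proof. exact: ind_gt0 u_basis. Qed.

Lemma pressure_functional_le0 (phi : A -> R[i]) : is_state phi ->
  (pressure_functional T rho0 b phi <= 0)%E.
Proof.
move=> [phi_lin _ _].
have r_inv := mulr_cfun_inv rho0_gt0.
(* For this test function the numerator in the entropy is [L (ind u * b) = 1], so the logarithm is
   that of the inverse of [b]. *)
pose a := cfun_inv rho0 * b.
have ra : rho0 * a = b by rewrite mulrA r_inv mul1r.
have a0 : strictly_positive a by apply: strictly_positiveM => //; exact: strictly_positive_inv.
have : (Ent T rho0 phi <= (- complex.Re (phi (cfun_ln b)))%:E)%E.
  apply: ereal_inf_lbound; exists a => //.
  rewrite tE ra [ind u * b]mulrC b_norm mul1r cfun_lnV// scalarN//.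
  by case: (phi _).
move=> /(leeD2r (complex.Re (phi (cfun_ln b)))%:E) /le_trans; apply.
by rewrite -EFinD addNr.
Qed.

(** By [transfer_fibre_sum] this is the Ruelle operator of the potential [b] at [x], the sum of
    [b y * a y] over the fibre; [b_norm] makes it unital. *)
Let normalized x (a : A) := L (b * ind u * a) x.

Let normalized_lin x : scalar (normalized x).
Proof.
move=> k c d; have [L_lin _ _] := L_transfer.
by rewrite /normalized mulrDr -scalerAr L_lin.
Qed.

Let normalized_pos x a : positive_elt a -> 0 <= normalized x a.
Proof.
move=> /positive_eltP a_ge0; have [_ L_pos _] := L_transfer.
have bu0 := strictly_positiveM b_gt0 i_gt0.
apply: (positive_eltP _).1 => //; apply/L_pos/positive_eltP => y.
by rewrite cfunME mulr_ge0// ltW.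
Qed.

Let normalized1 x : normalized x 1 = 1.
Proof. by rewrite /normalized mulr1 b_norm. Qed.

Lemma pressure_functional_ge0 (phi : A -> R[i]) : is_state phi ->
  (forall a, phi (L (b * ind u * a)) = phi a) ->
  (0 <= pressure_functional T rho0 b phi)%E.
Proof.
move=> [phi_lin phi_pos _] phiP.
have : ((- complex.Re (phi (cfun_ln b)))%:E <= Ent T rho0 phi)%E.
  apply: le_ereal_inf_tmp => _ [a a0 <-]; rewrite lee_fin.
  have r0 : strictly_positive (rho0 * a) := strictly_positiveM rho0_gt0 a0.
  (* Dividing by [b] writes the numerator in the entropy as the Ruelle operator applied to [c]. *)
  pose c := rho0 * a * cfun_inv b.
  have c0 : strictly_positive c := strictly_positiveM r0 (strictly_positive_inv b_gt0).
  have tc : transfer T rho0 a = L (b * ind u * c).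
    rewrite tE; congr L; rewrite [b * _]mulrC -mulrA; congr (_ * _).
    by rewrite /c mulrCA (mulr_cfun_inv b_gt0) mulr1.
  have t0 : strictly_positive (transfer T rho0 a).
    move=> x; rewrite tc.
    exact: (functional_gt0 (normalized_lin x) (@normalized_pos x) (normalized1 x)).
  have jensen : phi (cfun_ln c) <= phi (cfun_ln (transfer T rho0 a)).
    (* Jensen holds at each point; applying [phi] and its invariance [phiP] then reduces the left
       side to [phi (cfun_ln c)]. *)
    have key x : L (b * ind u * cfun_ln c) x <= cfun_ln (transfer T rho0 a) x.
      rewrite (cfun_lnE x t0) tc.
      exact: (functional_jensen (normalized_lin x) (@normalized_pos x) (normalized1 x)).
    have := functional_le phi_lin phi_pos key.
    by rewrite (phiP (cfun_ln c)).
  have split_c := congr1 phi (cfun_ln_div r0 b_gt0).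
  have split_t := congr1 phi (cfun_ln_div t0 r0).
  rewrite scalarB// in split_c; rewrite scalarB// in split_t.
  (* Here [p], [q], [s], [t], [w] are the values of [phi] at the logarithms of [c], of the
     transferred function, of [rho0 * a], of [b], and of the entropy quotient. *)
  have arith (p q s t w : R[i]) : p <= q -> p = s - t -> w = q - s ->
      - complex.Re t <= complex.Re w.
    move=> + pE ->; rewrite pE; case: q s t {pE} => [q1 q2] [s1 s2] [t1 t2].
    by rewrite lecE/= => /andP[_]; lra.
  exact: arith jensen split_c split_t.
move=> /(leeD2r (complex.Re (phi (cfun_ln b)))%:E); apply: le_trans.
by rewrite -EFinD addNr.
Qed.

Lemma equilibrium_of_transfer_invariant (phi : A -> R[i]) : is_state phi ->
  (forall a, phi (L (b * ind u * a)) = phi a) -> equilibrium_state T rho0 b phi.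
Proof.
move=> phi_state phiP.
have phi_inv : invariant_state T phi.
  (* The transfer identity pulls [a] out: [L (alpha T a * (b * ind u)) = a * L (b * ind u) = a]. *)
  split=> // a; rewrite -phiP mulrC; have [_ _ ->] := L_transfer.
  by rewrite b_norm mulr1.
split=> //; apply/eqP; rewrite eq_le; apply/andP; split.
  by apply: ereal_sup_ubound; exists phi.
apply: (@le_trans _ _ 0%E); last exact: pressure_functional_ge0.
by apply: ge_ereal_sup => _ [psi [psi_state _] <-]; exact: pressure_functional_le0.
Qed.

End Equilibrium.

Theorem proposition24 (R : realType) (X : ptopologicalType) (T : X -> X)
    (L : cfun R X -> cfun R X) (m : nat) (u : 'I_m -> cfun R X)
    (h : cfun R X) (beta : R)
    (B : cstarAlgType R) (j : cfun R X -> B) (S : B) (F : B -> cfun R X)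
    (sigma : R -> B -> B) (phi : cfun R X -> R[i]) (rho0 : cfun R X) :
  compact [set: X] -> hausdorff_space X -> local_homeomorphism T ->
  injective (alpha T : cfun R X -> cfun R X) ->
  transfer_operator T L -> L 1 = 1 ->
  quasi_basis (alpha T \o L) u ->
  strictly_positive h ->
  is_crossed_product T L j S ->
  canonical_expectation T (ind u) j S F ->
  dynamics h j S sigma ->
  is_state phi -> kms_state sigma beta (phi \o F) ->
  let Lambda := cfun_pow h (- beta) * ind u in
  L (Lambda * 1) = 1 ->
  strictly_positive rho0 ->
  equilibrium_state T rho0 (cfun_pow h (- beta)) phi.
Proof.
move=> X_compact X_hausdorff T_homeo _ L_transfer L1 u_basis h_gt0 BP FP sigmaP
  phi_state phi_kms Lambda L_norm rho0_gt0.
have i_gt0 := ind_gt0 T_homeo u_basis.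
have {}L_norm : L (cfun_pow h (- beta) * ind u) = 1 by rewrite -[RHS]L_norm mulr1.
have Q := kms_transfer_invariant BP X_compact h_gt0 FP sigmaP phi_kms i_gt0.
have P := strictly_positive_pow (- beta) h_gt0.
exact: (equilibrium_of_transfer_invariant X_compact X_hausdorff T_homeo L_transfer
  L1 u_basis P rho0_gt0 L_norm phi_state Q).
Qed.
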